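(* Let $C\in\mathrm{Cat}(m,n)$ be a realizable Catalan state with no bottom returns. Then $$\beta(C)=mn+\frac{m(m-1)}{2}+\sum_{(p,q)\in S(C)}\min\{\iota_{m,n}(p),\,1-\iota_{m,n}(q)\}.$$
   Context: $\mathrm{Cat}(m,n)$ is the set of Catalan states: non-crossing perfect matchings, by arcs embedded in a rectangle, of $2(m+n)$ boundary points: $x_1,\dots,x_n$ on the top side (left to right), $x'_1,\dots,x'_n$ on the bottom side (left to right), $y_1,\dots,y_m$ on the left side and $y'_1,\dots,y'_m$ on the right side (both top to bottom). Extended labels: $x_i=y_{1-i}=y'_{i-n}$ for $1\le i\le n$. A bottom return is an arc joining two bottom points. Realizability. The lattice crossing $L(m,n)$ is the grid of $m$ horizontal lines (joining $y_j$ to $y'_j$) and $n$ vertical lines (joining $x_i$ to $x'_i$). A Kauffman state $s$ assigns a marker $\pm1$ to each crossing: a marker $+1$ smooths the crossing by joining its top half-edge to its right one and its left half-edge to its bottom one; $-1$ joins top to left and bottom to right. $C_s$ is the Catalan state left after discarding closed components. $C$ is realizable if $C=C_s$ for some $s$. Sequences. A sequence $\mathbf{b}=(b_1,\dots,b_m)$ with $0\le b_j\le n$ determines the Kauffman state whose $j$-th row (from the top) has markers $(1,\dots,1,-1,\dots,-1)$ read left to right, with $b_j$ ones followed by $n-b_j$ minus ones; $\mathbf b$ realizes $C$ if this state realizes $C$. $\mathfrak b(C)$ is the set of sequences realizing $C$, $\Vert\mathbf b\Vert=b_1+\dots+b_m$, and $\beta(C)=\max\{\Vert\mathbf b\Vert:\mathbf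 b\in\mathfrak b(C)\}$ ($\mathfrak b(C)\neq\emptyset$ when $C$ is realizable with no bottom returns). Coordinates. On top-, left- and right-boundary points, $\iota_{m,n}(y'_i)=i$ for $1-n\le i\le m$ (so $\iota_{m,n}(x_i)=i-n$) and $\iota_{m,n}(y_i)=-n+1-i$ for $1\le i\le m$. An arc with neither end on the bottom boundary is written $(p,q)$ with $\iota_{m,n}(p)<\iota_{m,n}(q)$. $S(C)$ is the set of all arcs $(p,q)$ of $C$ with neither $p$ nor $q$ on the bottom boundary. *)

(* Defs.v *)
From HB Require Import structures.
From mathcomp Require Import all_boot all_order all_algebra.

Set Implicit Arguments.
Unset Strict Implicit.
Unset Printing Implicit Defensive.

Import Order.TTheory GRing.Theory Num.Theory.

(** Indices are 0-based: [Top i], [Bottom i], [Left j], [Right j] stand for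
    x_(i+1), x'_(i+1), y_(j+1), y'_(j+1). *)
Inductive bpoint (m n : nat) : Type :=
  | Top of 'I_n
  | Bottom of 'I_n
  | Left of 'I_m
  | Right of 'I_m.

Arguments Top {m n} _.
Arguments Bottom {m n} _.
Arguments Left {m n} _.
Arguments Right {m n} _.

Definition bpoint_to_sum m n (p : bpoint m n) : 'I_n + 'I_n + ('I_m + 'I_m) :=
  match p with
  | Top i => inl (inl i)
  | Bottom i => inl (inr i)
  | Left j => inr (inl j)
  | Right j => inr (inr j)
  end.

Definition bpoint_of_sum m n (x : 'I_n + 'I_n + ('I_m + 'I_m)) : bpoint m n :=
  match x with
  | inl (inl i) => Top i
  | inl (inr i) => Bottom i
  | inr (inl j) => Left j
  | inr (inr j) => Right j
  end.

Lemma bpoint_to_sumK m n : cancel (@bpoint_to_sum m n) (@bpoint_of_sum m n).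
Proof. by case. Qed.

HB.instance Definition _ (m n : nat) :=
  Equality.copy (bpoint m n) (can_type (@bpoint_to_sumK m n)).
HB.instance Definition _ (m n : nat) :=
  Choice.copy (bpoint m n) (can_type (@bpoint_to_sumK m n)).
HB.instance Definition _ (m n : nat) :=
  Countable.copy (bpoint m n) (can_type (@bpoint_to_sumK m n)).
HB.instance Definition _ (m n : nat) : isFinite (bpoint m n) :=
  CanIsFinite (@bpoint_to_sumK m n).

Definition is_bottom m n (p : bpoint m n) : bool :=
  if p is Bottom _ then true else false.

(** Rank of a boundary point when the boundary of the rectangle is traversed
    clockwise from its bottom-left corner:
    y_m, ..., y_1, x_1, ..., x_n, y'_1, ..., y'_m, x'_n, ..., x'_1. *)
Definition cyclic_pos m n (p : bpoint m n) : nat :=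
  match p with
  | Left j => m - j.+1
  | Top i => m + i
  | Right j => m + n + j
  | Bottom i => m + n + m + (n - i.+1)
  end.

Definition perfect_matching (T : finType) (f : {ffun T -> T}) : bool :=
  [forall p, (f p != p) && (f (f p) == p)].

Definition noncrossing m n (f : {ffun bpoint m n -> bpoint m n}) : bool :=
  [forall p, forall q,
    ~~ [&& cyclic_pos p < cyclic_pos q,
           cyclic_pos q < cyclic_pos (f p)
         & cyclic_pos (f p) < cyclic_pos (f q)]].

(** A Catalan state, up to isotopy: [C p] is the other end of the arc at [p]. *)
Record Cat (m n : nat) : Type := MkCat {
  mate :> {ffun bpoint m n -> bpoint m n};
  mate_matching : perfect_matching mate;
  mate_noncrossing : noncrossing mate
}.

Definition no_bottom_returns m n (C : Cat m n) : Prop :=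
  forall p : bpoint m n, is_bottom p -> ~~ is_bottom (C p).

(** Edges of the grid L(m,n), cut at its crossings: [inl (j, k)] is the piece of
    horizontal line j between vertical lines k-1 and k (0-based), and
    [inr (k, i)] the piece of vertical line i between horizontal lines k-1 and k;
    the extreme values of k give the pieces ending on the boundary. *)
Definition edge (m n : nat) : finType := ('I_m * 'I_n.+1 + 'I_m.+1 * 'I_n)%type.

Section Crossing.
Variables (m n : nat) (j : 'I_m) (i : 'I_n).
Definition left_edge : edge m n := inl (j, widen_ord (leqnSn n) i).
Definition right_edge : edge m n := inl (j, lift ord0 i).
Definition top_edge : edge m n := inr (widen_ord (leqnSn m) j, i).
Definition bottom_edge : edge m n := inr (lift ord0 j, i).
End Crossing.

Definition boundary_edge m n (p : bpoint m n) : edge m n :=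
  match p with
  | Top i => inr (ord0, i)
  | Bottom i => inr (ord_max, i)
  | Left j => inl (j, ord0)
  | Right j => inl (j, ord_max)
  end.

(** [s j i] is the marker at the crossing of horizontal line j and vertical
    line i; [true] is +1 and [false] is -1. *)
Definition kauffman_state (m n : nat) : Type := 'M[bool]_(m, n).

Definition smoothing m n (s : kauffman_state m n) (j : 'I_m) (i : 'I_n) :
    seq (edge m n * edge m n) :=
  if s j i
  then [:: (top_edge j i, right_edge j i); (left_edge j i, bottom_edge j i)]
  else [:: (top_edge j i, left_edge j i); (bottom_edge j i, right_edge j i)].

Definition joined m n (s : kauffman_state m n) : rel (edge m n) :=
  fun e f => [exists j, exists i,
    ((e, f) \in smoothing s j i) || ((f, e) \in smoothing s j i)].

(** The arcs of C_s: closed components contain no boundary point, so they are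
    discarded automatically. *)
Definition state_arc m n (s : kauffman_state m n) : rel (bpoint m n) :=
  fun p q => (p != q) && connect (joined s) (boundary_edge p) (boundary_edge q).

Definition realizes m n (s : kauffman_state m n) (C : Cat m n) : bool :=
  [forall p, forall q, (C p == q) == state_arc s p q].

Definition realizable m n (C : Cat m n) : Prop :=
  exists s : kauffman_state m n, realizes s C.

Definition seq_state m n (b : m.-tuple 'I_n.+1) : kauffman_state m n :=
  (\matrix_(j < m, i < n) (i < tnth b j)%N)%R.

Definition realizing_seqs m n (C : Cat m n) : {set m.-tuple 'I_n.+1} :=
  [set b | realizes (seq_state b) C].

Definition seq_norm m n (b : m.-tuple 'I_n.+1) : nat := \sum_(j < m) tnth b j.

(** The set is nonempty when [C] is realizable with no bottom returns; otherwise
    the maximum over the empty set is 0 by convention. *)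
Definition beta m n (C : Cat m n) : nat :=
  \max_(b in realizing_seqs C) seq_norm b.

Local Open Scope ring_scope.

(** The value on bottom points is a dummy; [upper_arcs] excludes them. *)
Definition iota_coord m n (p : bpoint m n) : int :=
  match p with
  | Top i => i.+1%:Z - n%:Z
  | Left j => - n%:Z + 1 - j.+1%:Z
  | Right j => j.+1%:Z
  | Bottom _ => 0
  end.

(** S(C); the last condition orients each arc, so that it is counted once. *)
Definition upper_arcs m n (C : Cat m n) : {set bpoint m n * bpoint m n} :=
  [set pq | [&& C pq.1 == pq.2, ~~ is_bottom pq.1, ~~ is_bottom pq.2
              & iota_coord pq.1 < iota_coord pq.2]].

(* Main.v *)
Require Import Defs.
From mathcomp Require Import all_boot all_order all_algebra zify.

(** Smoothing a row by the markers 1^k (-1)^(n-k) has a simple effect on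
    strands: line up, from left to right, the left end of the row, the n strands
    coming from above and the right end of the row.  The entries number k and
    k+1 (counting from 0) of this list get joined by a cup, and the other n
    entries go on to the next row in the same order.  So a sequence realizes a
    state without bottom returns exactly when each of its rows joins two
    neighbouring entries that are the ends of an arc of C; the n strands left at
    the end then reach the bottom in the only planar way ([realizes_cups],
    [cups_realize], [pending_mates]).

    Write a boundary point as its clockwise rank x, so that iota = x + 1 - (m+n)
    off the bottom side.  At row t (from 0) the entries are points of the window
    m-t-1 .. m+n+t, in increasing order.  If the cup of row t joins x to y > x,
    then b_t counts the entries before x, so b_t is at most
    x - (m-t-1) = n + t + iota x; and b_t <= n <= n + (m+n+t-y), which is
    n + t + 1 - iota y, since y lies in the window.  Each arc of S(C) is the cup
    of exactly one row, so summing over the rows bounds every norm by the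
    right-hand side.

    Equality holds for the greedy sequence, which always closes the rightmost
    cup available.  It exists because C is realizable: by a cut argument at most
    n points of a window have their mate outside it, so that among the n+2
    entries of a row some two are mates, and then an innermost such pair is
    adjacent ([realizable_few_unmatched], [greedy_cup]).  It is optimal at each
    row: if a point to the left of x has been closed off in an earlier row s,
    then greediness says that the arc (x, y) was not available at row s, so that
    y entered after row s; and then the arc is closed as soon as y enters, so
    y = m+n+t is the last entry and b_t = n ([greedy_late]).  Otherwise all
    points of the window before x are entries, and b_t = x - (m-t-1)
    ([greedy_value]). *)

Set Implicit Arguments.
Unset Strict Implicit.
Unset Printing Implicit Defensive.
Import Order.TTheory GRing.Theory Num.Theory.

(** * Strands through rows with markers 1^k (-1)^(n-k) *)

Section Rows.
Variables (m n : nat) (b : nat -> nat).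

(** The new ends of a row are the left and right boundary points at its height,
    in the clockwise ranks of [cyclic_pos]. *)
Definition extend t (w : seq nat) := (m - t.+1) :: rcons w (m + n + t).

Definition delete k (e : seq nat) := take k e ++ drop k.+2 e.

(** Ranks of the boundary points whose strands cross the horizontal level just
    above row [t]; initially these are the top points. *)
Fixpoint pending t :=
  if t is u.+1 then delete (b u) (extend u (pending u)) else iota m n.
Arguments pending : simpl never.
Definition entries t := extend t (pending t).

(** The ends of the cup that row [t] closes. *)
Definition lo t := nth 0 (entries t) (b t).
Definition hi t := nth 0 (entries t) (b t).+1.
Definition removed t := flatten [seq [:: lo s; hi s] | s <- iota 0 t].

Lemma pendingS t : pending t.+1 = delete (b t) (entries t).
Proof. by []. Qed.

Hypothesis b_le : forall t, b t <= n.

Lemma nth_delete k e i : k <= size e ->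
  nth 0 (delete k e) i = nth 0 e (if i < k then i else i.+2).
Proof.
move=> ke; rewrite /delete nth_cat size_takel // nth_drop.
by case: ifP => ik; [rewrite nth_take | congr nth; lia].
Qed.

Lemma size_pending t : size (pending t) = n.
Proof.
elim: t => [|t IH]; first by rewrite size_iota.
rewrite pendingS /delete size_cat size_take size_drop /= size_rcons IH.
have := b_le t; case: ifP; lia.
Qed.

Lemma size_entries t : size (entries t) = n.+2.
Proof. by rewrite /= size_rcons size_pending. Qed.

Lemma mem_removedP t x :
  reflect (exists2 s, s < t & x = lo s \/ x = hi s) (x \in removed t).
Proof.
apply: (iffP flatten_mapP) => [[s]|[s st xs]].
  rewrite mem_iota !inE => st xs; exists s => //.
  by case/orP: xs => /eqP ->; [left|right].
exists s; first by rewrite mem_iota.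
by rewrite !inE; case: xs => ->; rewrite eqxx ?orbT.
Qed.

Lemma removedS t : removed t.+1 = removed t ++ [:: lo t; hi t].
Proof. by rewrite /removed -addn1 iotaD map_cat flatten_cat. Qed.

Lemma perm_delete k (e : seq nat) : k.+1 < size e ->
  perm_eq (delete k e ++ [:: nth 0 e k; nth 0 e k.+1]) e.
Proof.
move=> ke; apply/permP=> a.
rewrite -[X in _ = count _ X](cat_take_drop k) /delete !count_cat.
by rewrite (drop_nth 0 (ltnW ke)) (drop_nth 0 ke) /=; lia.
Qed.

Lemma perm_pending_entries t :
  perm_eq (pending t.+1 ++ removed t.+1) (entries t ++ removed t).
Proof.
rewrite removedS pendingS; apply/permP=> a.
rewrite [LHS]count_cat [RHS]count_cat [count a (removed t ++ _)]count_cat.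
have /permP/(_ a) :
    perm_eq (delete (b t) (entries t) ++ [:: lo t; hi t]) (entries t).
  by apply: perm_delete; rewrite size_entries !ltnS b_le.
by rewrite count_cat /=; lia.
Qed.

(** No point is lost: below the first [t] rows, the points of the window are
    those still pending and those already joined by a cup.  Everything about
    membership is read off from this. *)
Lemma perm_window t : t <= m ->
  perm_eq (pending t ++ removed t) (iota (m - t) (n + t.*2)).
Proof.
elim: t => [|t IH] tm; first by rewrite cats0 subn0 addn0.
apply: (perm_trans (perm_pending_entries t)); apply/permP=> a.
have /permP/(_ a) := IH (ltnW tm).
have -> : n + t.+1.*2 = (n + t.*2 + 1).+1 by lia.
have -> : iota (m - t.+1) (n + t.*2 + 1).+1
        = (m - t.+1) :: rcons (iota (m - t) (n + t.*2)) (m + n + t).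
  rewrite /= iotaD cats1 (_ : (m - t.+1).+1 = m - t); last by lia.
  by rewrite (_ : m - t + (n + t.*2) = m + n + t) //; lia.
by rewrite /entries /extend -!cats1 !count_cat /= !count_cat /=; lia.
Qed.

Lemma perm_entries t : t < m ->
  perm_eq (entries t ++ removed t) (iota (m - t.+1) (n + t.+1.*2)).
Proof.
move=> tm; rewrite -(permPl (perm_pending_entries t)); exact: perm_window.
Qed.

Lemma mem_pending t x : t <= m ->
  (x \in pending t) = (m - t <= x < m + n + t) && (x \notin removed t).
Proof.
move=> tm; have p := perm_window tm.
have : uniq (pending t ++ removed t) by rewrite (perm_uniq p) iota_uniq.
rewrite cat_uniq => /and3P[_ /hasPn dis _].
have := perm_mem p x; rewrite mem_cat mem_iota.
have -> : m - t + (n + t.*2) = m + n + t by lia.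
move=> <-; have := dis x.
by case: (x \in removed t) (x \in pending t) => [] [] //= /(_ isT).
Qed.

Lemma mem_entries t x : t < m ->
  (x \in entries t) = (m - t.+1 <= x <= m + n + t) && (x \notin removed t).
Proof.
move=> tm; have p := perm_entries tm.
have : uniq (entries t ++ removed t) by rewrite (perm_uniq p) iota_uniq.
rewrite cat_uniq => /and3P[_ /hasPn dis _].
have := perm_mem p x; rewrite mem_cat mem_iota.
have -> : m - t.+1 + (n + t.+1.*2) = (m + n + t).+1 by lia.
rewrite ltnS => <-; have := dis x.
by case: (x \in removed t) (x \in entries t) => [] [] //= /(_ isT).
Qed.

Lemma delete_subseq k (e : seq nat) : subseq (delete k e) e.
Proof.
rewrite -[X in subseq _ X](cat_take_drop k) cat_subseq // -addn2 addnC.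
by rewrite -drop_drop drop_subseq.
Qed.

Lemma sorted_extend t : t < m ->
  sorted ltn (pending t) -> sorted ltn (entries t).
Proof.
move=> tm pending_s.
have pending_in x : x \in pending t -> m - t.+1 < x < m + n + t.
  by rewrite mem_pending ?(ltnW tm) // => /andP[]; lia.
rewrite /= rcons_path; apply/andP; split.
  rewrite path_min_sorted //; apply/allP => x /pending_in; lia.
have := mem_last (m - t.+1) (pending t); rewrite inE.
move=> /orP[/eqP ->|/pending_in] /=; lia.
Qed.

Lemma sorted_pending t : t <= m -> sorted ltn (pending t).
Proof.
elim: t => [|t IH] tm; first exact: iota_ltn_sorted.
apply: (subseq_sorted ltn_trans (delete_subseq _ _)).
exact: (sorted_extend tm (IH (ltnW tm))).
Qed.

Lemma sorted_entries t : t < m -> sorted ltn (entries t).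
Proof. by move=> tm; apply: sorted_extend => //; apply/sorted_pending/ltnW. Qed.

Lemma nth_entries_lt t i j : t < m -> i < j -> j <= n.+1 ->
  nth 0 (entries t) i < nth 0 (entries t) j.
Proof.
move=> tm ij jn; apply: (sorted_ltn_nth ltn_trans 0 (sorted_entries tm)) => //;
  by rewrite inE size_entries; lia.
Qed.

Lemma mem_nth_entries t i : i <= n.+1 -> nth 0 (entries t) i \in entries t.
Proof. by move=> ni; rewrite mem_nth // size_entries. Qed.

Lemma entries_index t x :
  x \in entries t -> exists2 i, i <= n.+1 & x = nth 0 (entries t) i.
Proof.
move=> xt; exists (index x (entries t)); last by rewrite nth_index.
by rewrite -ltnS -(size_entries t) index_mem.
Qed.

Lemma lo_entries t : lo t \in entries t.
Proof. by apply: mem_nth_entries; rewrite (leq_trans (b_le t)). Qed.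

Lemma hi_entries t : hi t \in entries t.
Proof. by apply: mem_nth_entries; rewrite ltnS. Qed.

Lemma lo_lt_hi t : t < m -> lo t < hi t.
Proof. by move=> tm; apply: nth_entries_lt; rewrite ?ltnS. Qed.

(** Consecutive entries have no entry between them; with [i := b t] this says
    that nothing pending separates the two ends of a cup. *)
Lemma nth_entries_gap t i x : t < m -> i <= n -> x \in entries t ->
  nth 0 (entries t) i < x -> nth 0 (entries t) i.+1 <= x.
Proof.
move=> tm ni /entries_index[j jn ->] lt_ij; case: (ltngtP i j) => [ij|ij|ij].
- move: ij; rewrite leq_eqVlt => /orP[/eqP -> //|ij].
  by rewrite ltnW // nth_entries_lt.
- have := nth_entries_lt tm ij (leqW ni); lia.
- by move: lt_ij; rewrite ij ltnn.
Qed.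

(** Entries increase strictly from [m - t.+1], so the one of index [b t] is at
    least [b t] further. *)
Lemma b_le_lo t : t < m -> b t + (m - t.+1) <= lo t.
Proof.
move=> tm; have := b_le t; rewrite /lo; elim: (b t) => [|k IH] kn.
  by rewrite add0n.
have := IH (ltnW kn); have := @nth_entries_lt t k k.+1 tm (ltnSn k); lia.
Qed.

Lemma removed_before s t : s < t -> lo s \in removed t /\ hi s \in removed t.
Proof.
by move=> st; split; apply/mem_removedP; exists s => //; [left|right].
Qed.

Lemma lo_inj s t : s < m -> t < m -> lo s = lo t -> s = t.
Proof.
have lt_neq u v : u < v -> v < m -> lo u <> lo v.
  move=> uv vm e; have := lo_entries v.
  by rewrite -e mem_entries // (removed_before uv).1 andbF.
by move=> sm tm e; case: (ltngtP s t) => // st;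
  [case: (lt_neq _ _ st tm) | case: (lt_neq _ _ st sm)].
Qed.

End Rows.

Arguments pending : simpl never.

(** * Closing cups of a non-crossing matching, rightmost first *)

Section Cups.
Variables (m n : nat) (f : nat -> nat).
Hypothesis fK : involutive f.
Hypothesis f_noncross : forall x y, x < y -> y < f x -> f x < f y -> False.
Hypothesis f_nofix : forall x, x < m + n + m -> f x != x.
Variable b : nat -> nat.
Hypothesis b_le : forall t, b t <= n.

Notation entries := (entries m n b).
Notation lo := (lo m n b).
Notation hi := (hi m n b).
Notation removed := (removed m n b).

Lemma removed_closed t x : (forall s, s < t -> f (lo s) = hi s) ->
  x \in removed t -> f x \in removed t.
Proof.
move=> cup /mem_removedP[s st [->|->]]; rewrite -?(cup s st) ?fK ?(cup s st);
  by have [] := removed_before m n b st.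
Qed.

Lemma mate_in_entries t x : t < m -> (forall s, s < t -> f (lo s) = hi s) ->
  x \in entries t -> (f x \in entries t) = (m - t.+1 <= f x <= m + n + t).
Proof.
move=> tm cup; rewrite !mem_entries // => /andP[_ xr].
rewrite andb_idr // => _; apply: contra xr => /(removed_closed cup).
by rewrite fK.
Qed.

(** Between two mates that are both entries, everything still pending is matched
    within, by planarity: the neighbour of the left end either is its mate or
    starts a shorter such pair. *)
Lemma innermost_cup t x : t < m -> (forall s, s < t -> f (lo s) = hi s) ->
  x \in entries t -> f x \in entries t -> x < f x ->
  exists i, [/\ i <= n, x <= nth 0 (entries t) i
              & f (nth 0 (entries t) i) = nth 0 (entries t) i.+1].
Proof.
move=> tm cup; have [d] := ubnP (f x - x); elim: d x => // d IH x dx xt fxt lt.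
have [i i_le xi] := entries_index b_le xt.
have [k k_le fk] := entries_index b_le fxt.
have i_n : i <= n.
  rewrite leqNgt; apply/negP => ni; have ei : i = n.+1 by lia.
  case: (ltngtP k i) => ki; last by move: lt; rewrite fk xi ki ltnn.
    by have := nth_entries_lt b_le tm ki i_le; lia.
  lia.
have := nth_entries_gap b_le tm i_n fxt; rewrite -xi => /(_ lt).
rewrite leq_eqVlt => /orP[/eqP fx|y_lt]; first by exists i; rewrite -xi.
have := nth_entries_lt b_le tm (ltnSn i) i_n; rewrite -xi => x_lt.
have yt : nth 0 (entries t) i.+1 \in entries t by exact: mem_nth_entries.
have gap z : z \in entries t -> x < z -> nth 0 (entries t) i.+1 <= z.
  by rewrite xi; apply: nth_entries_gap.
set y := nth 0 (entries t) i.+1 in y_lt x_lt yt gap.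
have fy_lt : f y < f x.
  case: (ltngtP (f y) (f x)) => // [lt_fy|/(can_inj fK) eq_yx].
    by case: (f_noncross x_lt y_lt lt_fy).
  by rewrite eq_yx ltnn in x_lt.
have x_fy : x < f y.
  case: (ltngtP x (f y)) => // [fy_x|eq_x].
    by case: (@f_noncross (f y) x); rewrite ?fK.
  by move: y_lt; rewrite eq_x fK ltnn.
have fyt : f y \in entries t.
  rewrite mate_in_entries //; move: xt fxt; rewrite !mem_entries //.
  by move=> /andP[] /andP[? ?] _ /andP[] /andP[? ?] _; lia.
have y_fy : y < f y.
  rewrite ltn_neqAle gap // andbT eq_sym f_nofix //.
  by move: yt; rewrite mem_entries // => /andP[/andP[? ?] _]; lia.
have [j [jn yj fj]] := IH y ltac:(lia) yt fyt y_fy.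
by exists j; split => //; apply: leq_trans yj; apply: ltnW.
Qed.

(** The bottom points cannot be mates of points already closed, so they are the
    mates of the n strands left at the end; planarity reverses the clockwise
    order. *)
Lemma pending_mates :
  (forall x, m + n + m <= x < m + n + m + n -> f x < m + n + m) ->
  (forall s, s < m -> f (lo s) = hi s) ->
  map f (pending m n b m) = rev (iota (m + n + m) n).
Proof.
move=> bottom_up cup; set w := pending m n b m; set B := iota _ n.
have w_lt x : x \in w -> x < m + n + m.
  by rewrite mem_pending // => /andP[/andP[]].
have sub : {subset B <= map f w}.
  move=> x; rewrite mem_iota => xB; rewrite -(fK x) map_f //.
  rewrite mem_pending // subnn leq0n bottom_up //=.
  apply/negP => /(removed_closed cup); rewrite fK => /mem_removedP[s sm].
  have := lo_entries m b_le s; have := hi_entries m b_le s.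
  rewrite !mem_entries // => /andP[/andP[? ?] _] /andP[/andP[? ?] _].
  by case=> xs; lia.
have [|_ eqB] := uniq_min_size (iota_uniq _ _) sub.
  by rewrite size_map size_iota size_pending.
have w_mate x : x \in w -> m + n + m <= f x.
  by move=> /(map_f f); rewrite -eqB mem_iota => /andP[].
have gtn_trans : transitive (fun x y => y < x).
  by move=> y x z yx zy; apply: ltn_trans yx.
apply: (irr_sorted_eq gtn_trans ltnn).
- apply: (homo_sorted_in (P := mem w) (e := ltn)).
  + move=> x y /w_mate xN /w_lt yN xy.
    case: (ltngtP (f x) (f y)) => // [fxy|/(can_inj fK) e].
      case: (f_noncross xy _ fxy); lia.
    by move: xy; rewrite /= e ltnn.
  + by apply/allP.
  + exact: sorted_pending.
- by rewrite rev_sorted iota_ltn_sorted.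
- by move=> x; rewrite mem_rev eqB.
Qed.

Hypothesis b_max : forall t,
  b t = \max_(i < n.+1 | f (nth 0 (entries t) i) == nth 0 (entries t) i.+1) i.

(** The form in which greediness is used: no available arc starts to the right
    of the one that is closed. *)
Lemma greedy_innermost t x : t < m -> (forall s, s < t -> f (lo s) = hi s) ->
  x \in entries t -> f x \in entries t -> x < f x ->
  f (lo t) = hi t /\ x <= lo t.
Proof.
move=> tm cup xt fxt lt.
have [i [i_n xi fi]] := innermost_cup tm cup xt fxt lt.
pose P (i : 'I_n.+1) := f (nth 0 (entries t) i) == nth 0 (entries t) i.+1.
have Pi : P (Ordinal (i_n : i < n.+1)) by rewrite /P /= fi.
have b_ge : i <= b t by rewrite b_max; exact: (leq_bigmax_cond _ Pi).
split.
  have : 0 < #|P| by apply/card_gt0P; exists (Ordinal (i_n : i < n.+1)).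
  case/(eq_bigmax_cond (fun i : 'I_n.+1 => i : nat)) => k /eqP fk bk.
  have bk' : b t = k by rewrite b_max.
  by rewrite /lo /hi bk'.
apply: (leq_trans xi); move: b_ge; rewrite leq_eqVlt => /orP[/eqP -> //|ib].
by rewrite ltnW // nth_entries_lt // ltnW // ltnS.
Qed.

(** The counting condition that realizability provides: among more than n
    points of a window, one has its mate in that window. *)
Hypothesis few_unmatched : forall t, t < m -> forall s : seq nat, uniq s ->
  (forall x, x \in s -> (m - t.+1 <= x <= m + n + t) /\
                        ~~ (m - t.+1 <= f x <= m + n + t)) -> size s <= n.

Lemma greedy_cup t : t < m -> f (lo t) = hi t.
Proof.
elim/ltn_ind: t => t IH tm.
have cup s : s < t -> f (lo s) = hi s by move=> st; apply: IH => //; lia.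
have [/hasP[x xt fxt]|none] :=
  boolP (has (fun x => f x \in entries t) (entries t)).
  have : f x != x.
    apply: f_nofix.
    by move: xt; rewrite mem_entries // => /andP[/andP[? ?] _]; lia.
  rewrite neq_ltn => /orP[] lt.
    by apply: (proj1 (greedy_innermost tm cup fxt _ _)); rewrite fK.
  by apply: (proj1 (greedy_innermost tm cup xt fxt lt)).
suff : size (entries t) <= n by rewrite size_entries // ltnNge leqnSn.
apply: (few_unmatched tm).
  exact: (sorted_uniq ltn_trans ltnn (sorted_entries b_le tm)).
move=> x xt; have := hasPn none x xt; rewrite (mate_in_entries tm cup xt).
by move=> ->; move: xt; rewrite mem_entries // => /andP[].
Qed.

(** Once a cup has been closed to its left, an arc is closed in the row where its
    right end enters.  That end entered after row [s], or the arc would have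
    been preferred there.  If it entered at a row [u < t], then greediness made
    row [u] close an arc inside [(lo t, hi t)]; this inner arc also lies right of
    the cup of row [s], so by induction its right end is the last entry of row
    [u], which is [hi t]: a contradiction. *)
Lemma greedy_late s t : s < t -> t < m -> hi s < lo t -> hi t = m + n + t.
Proof.
elim/ltn_ind: t => t IH st tm sep.
have cup u : u < m -> f (lo u) = hi u by exact: greedy_cup.
have [s_m lo_hi] : s < m /\ lo t < hi t.
  by split; [exact: ltn_trans tm | exact: lo_lt_hi].
have := hi_entries m b_le t; have := lo_entries m b_le t.
have := lo_entries m b_le s; have := lo_lt_hi b_le s_m.
rewrite !mem_entries //.
move=> s_lt /andP[/andP[s1 s2] s3] /andP[/andP[l1 l2] l3] /andP[/andP[h1 h2] h3].
have fresh x u : u <= t -> x \notin removed t -> x \notin removed u.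
  move=> ut; apply: contra => /mem_removedP[v vu xv].
  by apply/mem_removedP; exists v => //; exact: leq_trans ut.
have below u : u <= t -> u < m -> m - u.+1 <= lo t -> hi t <= m + n + u ->
    lo t <= lo u.
  move=> ut um w1 w2.
  have cup' v : v < u -> f (lo v) = hi v by move=> vu; apply: cup; lia.
  have lo_u : lo t \in entries u.
    by rewrite mem_entries // (fresh _ _ ut l3) andbT; lia.
  have hi_u : f (lo t) \in entries u.
    by rewrite cup // mem_entries // (fresh _ _ ut h3) andbT; lia.
  by have [|_ //] := greedy_innermost um cup' lo_u hi_u; rewrite ?cup.
have late : m + n + s < hi t.
  rewrite ltnNge; apply/negP => early.
  have := below s (ltnW st) s_m; lia.
pose u := hi t - (m + n); have [ut|ut] : u < t \/ u = t by rewrite /u; lia.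
  2: by move: ut; rewrite /u; lia.
have um : u < m by lia.
have := below u (ltnW ut) um ltac:(lia) ltac:(rewrite /u; lia).
rewrite leq_eqVlt => /orP[/eqP e|lt].
  by have := lo_inj b_le tm um e; lia.
have := IH u ut ltac:(rewrite /u; lia) um ltac:(lia).
have -> : m + n + u = hi t by rewrite /u; lia.
rewrite -!cup // => /(can_inj fK) e; by rewrite e ltnn in lt.
Qed.

(** Either no point before [lo t] has been closed, and the entries up to [lo t]
    are consecutive numbers, or [greedy_late] applies. *)
Lemma greedy_value t : t < m ->
  (b t + (m - t.+1) = lo t) \/ (b t = n /\ hi t = m + n + t).
Proof.
move=> tm.
have [/hasP[x /mem_removedP[s st xs] x_lt]|/hasPn none]
  := boolP (has (fun x => x < lo t) (removed t)).
  right; have hi_t : hi t = m + n + t.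
    apply: (greedy_late st tm); have s_m := ltn_trans st tm.
    have := lo_entries m b_le t.
    rewrite mem_entries // => /andP[/andP[l1 l2] l3].
    have lo_s : lo s < lo t.
      by have := lo_lt_hi b_le s_m; case: xs x_lt => ->; lia.
    rewrite ltnNge; apply/negP => hi_s.
    have lo_t : lo t \in entries s.
      have := lo_entries m b_le s; have := hi_entries m b_le s.
      rewrite !mem_entries // => /andP[/andP[? ?] _] /andP[/andP[? ?] _].
      apply/andP; split; first lia.
      apply: contra l3 => /mem_removedP[v vu xv].
      by apply/mem_removedP; exists v => //; exact: ltn_trans st.
    (* an arc of row s around lo t would not have had adjacent ends *)
    have hi_le : hi s <= lo t := nth_entries_gap b_le s_m (b_le s) lo_t lo_s.
    have e : lo t = hi s by lia.
    by move: l3; rewrite e (removed_before m n b st).2.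
  split=> //; apply/eqP; rewrite eqn_leq b_le leqNgt; apply/negP => bn.
  have next_lt : hi t < nth 0 (entries t) (b t).+2.
    by apply: nth_entries_lt => //; lia.
  have := mem_nth_entries m b_le t (i := (b t).+2) ltac:(lia).
  by rewrite mem_entries // => /andP[/andP[? ?] _]; lia.
left; apply/eqP; rewrite eqn_leq b_le_lo //=.
have consecutive i : i <= b t -> nth 0 (entries t) i <= i + (m - t.+1).
  elim: i => [|i IH] ib; first by rewrite add0n.
  have i_lt : nth 0 (entries t) i < lo t.
    by apply: nth_entries_lt; rewrite // ltnW // ltnS.
  have next : (nth 0 (entries t) i).+1 \in entries t.
    move: i_lt; rewrite leq_eqVlt => /orP[/eqP ->|i_lt]; first exact: lo_entries.
    have := lo_entries m b_le t.
    have := mem_nth_entries m b_le t (i := i) ltac:(have := b_le t; lia).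
    rewrite !mem_entries // => /andP[/andP[? ?] _] /andP[/andP[? ?] _].
    apply/andP; split; first by lia.
    by apply/negP => /none; rewrite i_lt.
  have := nth_entries_gap b_le tm _ next (ltnSn _).
  have := b_le t; have := IH (ltnW ib); lia.
exact: consecutive.
Qed.

End Cups.

Section Greedy.
Variables (m n : nat) (f : nat -> nat).

(** Without any cup this is 0, a dummy value that [greedy_cup] rules out. *)
Definition last_cup (e : seq nat) : nat :=
  \max_(i < n.+1 | f (nth 0 e i) == nth 0 e i.+1) i.

(** The greedy sequence depends at each row on the strands that its earlier terms
    leave, hence the two are defined together. *)
Fixpoint greedy_pending t : seq nat :=
  if t is u.+1 then
    let e := extend m n u (greedy_pending u) in delete (last_cup e) e
  else iota m n.

Definition greedy t := last_cup (extend m n t (greedy_pending t)).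

Lemma pending_greedy t : pending m n greedy t = greedy_pending t.
Proof. by elim: t => //= t IH; rewrite pendingS /entries IH. Qed.

Lemma greedy_le t : greedy t <= n.
Proof. by apply/bigmax_leqP => i _; rewrite -ltnS. Qed.

Lemma greedyE t : greedy t = last_cup (entries m n greedy t).
Proof. by rewrite /entries pending_greedy. Qed.

End Greedy.

(** * Catalan states on clockwise ranks *)

Section Positions.
Variables (m n : nat) (C : Cat m n).

Lemma cyclic_pos_lt (p : bpoint m n) : cyclic_pos p < m + n + m + n.
Proof. by case: p => i /=; have := ltn_ord i; lia. Qed.

Lemma cyclic_pos_inj : injective (@cyclic_pos m n).
Proof.
move=> [] i [] j /= e; try (congr (_ _); apply: val_inj => /=);
  have := ltn_ord i; have := ltn_ord j; lia.
Qed.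

Lemma is_bottom_pos (p : bpoint m n) :
  is_bottom p = (m + n + m <= cyclic_pos p).
Proof. by case: p => i /=; have := ltn_ord i; lia. Qed.

Lemma cyclic_pos_surj x :
  x < m + n + m + n -> exists p : bpoint m n, cyclic_pos p = x.
Proof.
move=> xM; have [x1|x1] := ltnP x m.
  by exists (Left (Ordinal (ltac:(lia) : m - x.+1 < m))) => /=; lia.
have [x2|x2] := ltnP x (m + n).
  by exists (Top (Ordinal (ltac:(lia) : x - m < n))) => /=; lia.
have [x3|x3] := ltnP x (m + n + m).
  by exists (Right (Ordinal (ltac:(lia) : x - (m + n) < m))) => /=; lia.
by exists (Bottom (Ordinal (ltac:(lia) : m + n + m + n - x.+1 < n))) => /=; lia.
Qed.

(** Extended by the identity beyond the boundary ranks, so that it is an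
    involution of all of nat. *)
Definition mate_pos (x : nat) : nat :=
  if [pick p : bpoint m n | cyclic_pos p == x] is Some p then cyclic_pos (C p)
  else x.

Lemma mate_posE p : mate_pos (cyclic_pos p) = cyclic_pos (C p).
Proof.
rewrite /mate_pos; case: pickP => [q /eqP/cyclic_pos_inj -> //|/(_ p)].
by rewrite eqxx.
Qed.

Lemma mate_pos_out x : m + n + m + n <= x -> mate_pos x = x.
Proof.
rewrite /mate_pos; case: pickP => // p /eqP <-.
by rewrite leqNgt cyclic_pos_lt.
Qed.

Lemma mateK : involutive C.
Proof. by move=> p; have /forallP/(_ p)/andP[_ /eqP] := mate_matching C. Qed.

Lemma mate_neq p : C p != p.
Proof. by have /forallP/(_ p)/andP[] := mate_matching C. Qed.

Lemma mate_posK : involutive mate_pos.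
Proof.
move=> x; have [/cyclic_pos_surj[p <-]|xM] := ltnP x (m + n + m + n).
  by rewrite !mate_posE mateK.
by rewrite !mate_pos_out.
Qed.

Lemma mate_pos_neq x : x < m + n + m + n -> mate_pos x != x.
Proof.
case/cyclic_pos_surj=> p <-; rewrite mate_posE.
by apply: contra (mate_neq p) => /eqP/cyclic_pos_inj ->.
Qed.

Lemma mate_pos_noncross x y :
  x < y -> y < mate_pos x -> mate_pos x < mate_pos y -> False.
Proof.
move=> xy yx fxy; have [xM|xM] := ltnP x (m + n + m + n); last first.
  by rewrite mate_pos_out // in yx; lia.
have [p px] := cyclic_pos_surj xM; rewrite -px mate_posE in xy yx fxy.
have [q qy] := cyclic_pos_surj (ltn_trans yx (cyclic_pos_lt _)).
rewrite -qy ?mate_posE in xy yx fxy.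
have /forallP/(_ p)/forallP/(_ q) := mate_noncrossing C.
by rewrite xy yx fxy.
Qed.

Lemma mate_pos_bottom x : no_bottom_returns C ->
  m + n + m <= x < m + n + m + n -> mate_pos x < m + n + m.
Proof.
move=> nb /andP[xN /cyclic_pos_surj[p px]]; rewrite -px mate_posE.
by rewrite ltnNge -is_bottom_pos nb // is_bottom_pos px.
Qed.

End Positions.

(** * States determined by a sequence *)

Lemma joined_sym m n (s : kauffman_state m n) : symmetric (joined s).
Proof.
by move=> e e'; apply: eq_existsb => j; apply: eq_existsb => i; rewrite orbC.
Qed.

Section States.
Variables (m n : nat) (C : Cat m n) (b : m.-tuple 'I_n.+1).

Definition ones t : nat := nth 0 [seq val i | i <- b] t.

Lemma ones_tnth (j : 'I_m) : ones j = tnth b j.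
Proof. by rewrite /ones (nth_map ord0) ?size_tuple // -tnth_nth. Qed.

Lemma ones_le t : ones t <= n.
Proof.
have [tm|tm] := ltnP t m; last by rewrite /ones nth_default // size_map size_tuple.
by rewrite (ones_tnth (Ordinal tm)) -ltnS.
Qed.

Notation f := (mate_pos C).
Notation pending := (pending m n ones).
Notation entries := (entries m n ones).
Notation conn := (connect (joined (seq_state b))).

Lemma nth_pendingS t i :
  nth 0 (pending t.+1) i = nth 0 (entries t) (if i < ones t then i else i.+2).
Proof.
rewrite pendingS nth_delete // (size_entries _ ones_le).
by rewrite (leq_trans (ones_le t)) // -addn2 leq_addr.
Qed.

Lemma nth_entriesS t i : i < n -> nth 0 (entries t) i.+1 = nth 0 (pending t) i.
Proof. by move=> i_n; rewrite /= nth_rcons (size_pending m ones_le) i_n. Qed.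

Lemma nth_entries_last t : nth 0 (entries t) n.+1 = m + n + t.
Proof. by rewrite /= nth_rcons (size_pending m ones_le) ltnn eqxx. Qed.

(** The boundary point from which the strand through an edge comes.  The
    horizontal edge of index [ones j] in row [j] is the bottom of the cup, where
    two strands meet; it is given the left one. *)
Definition label (e : edge m n) : nat :=
  match e with
  | inl (j, k) => nth 0 (entries j) (if k <= ones j then k : nat else k.+1)
  | inr (k, i) => nth 0 (pending k) i
  end.

Definition same_arc x y := (y == x) || (y == f x).

Lemma same_arc_sym x y : same_arc x y -> same_arc y x.
Proof. by case/orP=> /eqP ->; rewrite /same_arc ?mate_posK eqxx ?orbT. Qed.

Lemma same_arc_trans x y z : same_arc x y -> same_arc y z -> same_arc x z.
Proof.
by case/orP=> /eqP ->; case/orP=> /eqP ->; rewrite /same_arc ?mate_posK eqxx ?orbT.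
Qed.

Lemma joined_crossing (j : 'I_m) (i : 'I_n) :
  if i < ones j then
    joined (seq_state b) (top_edge j i) (right_edge j i) /\
    joined (seq_state b) (left_edge j i) (bottom_edge j i)
  else
    joined (seq_state b) (top_edge j i) (left_edge j i) /\
    joined (seq_state b) (bottom_edge j i) (right_edge j i).
Proof.
by rewrite ones_tnth; case: ifP => ib; split; apply/existsP; exists j;
  apply/existsP; exists i; rewrite /smoothing mxE ib !inE !eqxx ?orbT.
Qed.

(** Labels are invariant up to arcs of C under each smoothing, hence along
    connected components: a state whose cups are arcs of C connects nothing
    else. *)
Lemma joined_same_arc e e' :
  (forall j : 'I_m, f (lo m n ones j) = hi m n ones j) ->
  joined (seq_state b) e e' -> same_arc (label e) (label e').
Proof.
move=> cup; suff half j i : all (fun ee => same_arc (label ee.1) (label ee.2))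
                                (smoothing (seq_state b) j i).
  case/existsP=> j /existsP[i /orP[]] /(allP (half j i)) //.
  exact: same_arc_sym.
rewrite /smoothing mxE -ones_tnth; case: ifP => ib /=.
  rewrite nth_pendingS ib (ltnW ib) -nth_entriesS //.
  by rewrite /same_arc !eqxx.
rewrite nth_pendingS ib -nth_entriesS //; apply/andP; split; last first.
  by rewrite /same_arc eqxx.
case: ifP => ib2; last by rewrite /same_arc eqxx.
have <- : ones j = i by lia.
by apply: same_arc_sym; apply/orP; right; apply/eqP/esym/cup.
Qed.

Lemma conn_same_arc e e' :
  (forall j : 'I_m, f (lo m n ones j) = hi m n ones j) ->
  conn e e' -> same_arc (label e) (label e').
Proof.
move=> cup /connectP[p]; elim: p e => [|e1 p IH] e /=.
  by move=> _ ->; rewrite /same_arc eqxx.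
move=> /andP[/(joined_same_arc cup) ee1 /IH h /h]; exact: same_arc_trans.
Qed.

Lemma label_boundary p :
  (forall j : 'I_m, f (lo m n ones j) = hi m n ones j) ->
  map f (pending m) = rev (iota (m + n + m) n) ->
  same_arc (label (boundary_edge p)) (cyclic_pos p).
Proof.
move=> cup bot; case: p => [i|i|j|j] /=.
- by rewrite nth_iota // /same_arc eqxx.
- apply/orP; right; rewrite -(nth_map 0 0) ?(size_pending m ones_le) // bot.
  rewrite nth_rev size_iota // nth_iota //; by have := ltn_ord i; lia.
- by rewrite /same_arc eqxx.
- case: ifP => [n_le|_]; last by rewrite nth_entries_last /same_arc eqxx.
  have n_eq : ones j = n by have := ones_le j; lia.
  apply/orP; right; have := cup j.
  by rewrite /hi {1}n_eq nth_entries_last /lo n_eq => ->.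
Qed.

(** One step of the induction in [conn_pending]: through row [t], the strand of
    the [k]-th entry reaches the horizontal edge given by [label]. *)
Lemma conn_entries (t : 'I_m) (k : 'I_n.+2) p (k' : 'I_n.+1) :
  (forall (i : 'I_n) p, cyclic_pos p = nth 0 (pending t) i ->
     conn (boundary_edge p) (inr (widen_ord (leqnSn m) t, i))) ->
  cyclic_pos p = nth 0 (entries t) k ->
  k' = (if k <= ones t then k : nat else k.-1) :> nat ->
  conn (boundary_edge p) (inl (t, k')).
Proof.
case: k => k k_lt; rewrite [nat_of_ord (Ordinal k_lt)]/= => IH pk k'E.
case: k => [|k] in k_lt pk k'E.
  have -> : p = Left t by apply: cyclic_pos_inj; rewrite pk.
  by rewrite /= (_ : k' = ord0) ?connect0 //; apply: val_inj.
move: k_lt; rewrite !ltnS leq_eqVlt => /orP[/eqP kn|kn].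
  have -> : p = Right t by apply: cyclic_pos_inj; rewrite pk kn nth_entries_last.
  rewrite /= (_ : k' = ord_max) ?connect0 //; apply: val_inj.
  rewrite /= k'E kn /=.
  by have := ones_le t; case: ifP; lia.
rewrite nth_entriesS // in pk.
apply: connect_trans (IH (Ordinal kn) p pk) _; apply: connect1.
have := joined_crossing t (Ordinal kn); rewrite /=; case: ifP => kb [].
  move=> + _; rewrite /top_edge /right_edge.
  by congr joined; congr (inl (_, _)); apply: val_inj; rewrite /= k'E kb.
move=> + _; rewrite /top_edge /left_edge.
by congr joined; congr (inl (_, _)); apply: val_inj; rewrite /= k'E kb.
Qed.

Lemma conn_pending t (tm : t < m.+1) (i : 'I_n) p :
  cyclic_pos p = nth 0 (pending t) i ->
  conn (boundary_edge p) (inr (Ordinal tm, i)).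
Proof.
elim: t tm i p => [|t IH] tm i p.
  rewrite nth_iota // => pi; have -> : p = Top i by exact: cyclic_pos_inj.
  by rewrite /= (_ : Ordinal tm = ord0) ?connect0 //; apply: val_inj.
have tm' : t < m by [].
pose j := Ordinal tm'.
have {}IH (i' : 'I_n) p' : cyclic_pos p' = nth 0 (pending j) i' ->
     conn (boundary_edge p') (inr (widen_ord (leqnSn m) j, i')).
  move=> h; have := IH (leqW tm') i' p' h.
  by congr connect; congr (inr (_, _)); apply: val_inj.
rewrite nth_pendingS => pi; have i_n := ltn_ord i.
have -> : Ordinal tm = lift ord0 j by apply: val_inj.
have := joined_crossing j i; case: ifP pi => ib pi [].
  move=> _ /connect1; apply: connect_trans.
  by apply: (conn_entries (k := Ordinal (ltac:(lia) : i < n.+2)) IH pi);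
    rewrite /= ltnW.
move=> _; rewrite joined_sym => /connect1; apply: connect_trans.
apply: (conn_entries (k := Ordinal (ltac:(lia) : i.+2 < n.+2)) IH pi).
by rewrite /= /bump /=; case: ifP; lia.
Qed.

Lemma conn_cup (j : 'I_m) p q :
  cyclic_pos p = lo m n ones j -> cyclic_pos q = hi m n ones j ->
  conn (boundary_edge p) (boundary_edge q).
Proof.
move=> pj qj; have b_n := ones_le j.
have top (i : 'I_n) p' : cyclic_pos p' = nth 0 (pending j) i ->
     conn (boundary_edge p') (inr (widen_ord (leqnSn m) j, i)).
  move=> /(conn_pending (leqW (ltn_ord j))).
  by congr connect; congr (inr (_, _)); apply: val_inj.
apply: (@connect_trans _ _ (inl (j, Ordinal (b_n : ones j < n.+1)))).
  by apply: (conn_entries (k := Ordinal (ltac:(lia) : ones j < n.+2)) top pj);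
    rewrite /= leqnn.
rewrite (sym_connect_sym (@joined_sym _ _ _)).
by apply: (conn_entries (k := Ordinal (ltac:(lia) : (ones j).+1 < n.+2)) top qj);
  rewrite /= ltnn.
Qed.

Lemma conn_through (i : 'I_n) p : cyclic_pos p = nth 0 (pending m) i ->
  conn (boundary_edge p) (boundary_edge (Bottom i)).
Proof.
move=> /(conn_pending (ltnSn m)).
by congr connect; congr (inr (_, _)); apply: val_inj.
Qed.

(** As C is realized, two connected boundary points are the ends of an arc; so
    the cups traced by [conn_cup] are arcs of C. *)
Lemma realizes_cups :
  realizes (seq_state b) C ->
  forall t, t < m -> f (lo m n ones t) = hi m n ones t.
Proof.
move=> real t tm; pose j := Ordinal tm.
have := lo_entries m ones_le t; have := hi_entries m ones_le t.
rewrite !mem_entries //; try exact: ones_le.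
move=> /andP[/andP[_ h2] _] /andP[/andP[_ l2] _].
have [p pj] := @cyclic_pos_surj m n (lo m n ones t) ltac:(lia).
have [q qj] := @cyclic_pos_surj m n (hi m n ones t) ltac:(lia).
rewrite -pj -qj mate_posE; congr cyclic_pos; apply/eqP.
have /forallP/(_ p)/forallP/(_ q)/eqP -> := real.
rewrite /state_arc (conn_cup (j := j) pj qj) andbT.
by apply/eqP => pq; have := lo_lt_hi ones_le tm; rewrite -pj -qj pq ltnn.
Qed.

Lemma cups_realize : no_bottom_returns C ->
  (forall t, t < m -> f (lo m n ones t) = hi m n ones t) ->
  realizes (seq_state b) C.
Proof.
move=> nb cup.
have cup' (j : 'I_m) : f (lo m n ones j) = hi m n ones j by exact: cup.
have bot : map f (pending m) = rev (iota (m + n + m) n).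
  apply: pending_mates => //; [exact: mate_posK|exact: mate_pos_noncross|
    exact: ones_le|move=> x; exact: mate_pos_bottom].
have upper p : ~~ is_bottom p -> conn (boundary_edge p) (boundary_edge (C p)).
  rewrite is_bottom_pos -ltnNge => pN.
  have [|] := boolP (cyclic_pos p \in pending m).
    move=> /(nthP 0)[i]; rewrite (size_pending m ones_le) => i_n pi.
    have -> : C p = Bottom (Ordinal i_n).
      apply: cyclic_pos_inj; rewrite -mate_posE -pi.
      rewrite -(nth_map 0 0) ?(size_pending m ones_le) //.
      by rewrite bot nth_rev size_iota // nth_iota //=; lia.
    exact: conn_through.
  rewrite (mem_pending ones_le) // subnn leq0n pN /= negbK.
  move=> /mem_removedP[t tm].
  case=> pt; have := mate_posE C p; rewrite pt.
    by rewrite cup // => /esym; apply: (conn_cup (j := Ordinal tm)).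
  rewrite -cup // mate_posK => /esym qt.
  rewrite (sym_connect_sym (@joined_sym _ _ _)).
  exact: (conn_cup (j := Ordinal tm)).
have arc p : conn (boundary_edge p) (boundary_edge (C p)).
  have [pb|] := boolP (is_bottom p); last exact: upper.
  rewrite (sym_connect_sym (@joined_sym _ _ _)) -{2}(mateK C p).
  by apply/upper/nb.
apply/forallP=> p; apply/forallP=> q.
apply/eqP; apply/idP/idP => [/eqP <-|/andP[pq]].
  by rewrite /state_arc arc eq_sym mate_neq.
move=> /(conn_same_arc cup') lpq.
have := same_arc_trans (same_arc_sym (label_boundary p cup' bot)) lpq.
move/same_arc_trans/(_ (label_boundary q cup' bot)).
rewrite /same_arc mate_posE.
case/orP=> [/eqP/cyclic_pos_inj qp|/eqP/cyclic_pos_inj -> //].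
by rewrite qp eqxx in pq.
Qed.

End States.

(** * Realizability as a counting condition *)

Section Crossings.
Variables (m n : nat) (s : kauffman_state m n) (j0 : 'I_m).

(** The vertical edges of [cut] lie below the crossings of row [j0] and are
    excluded, so that every strand leaving the upper part passes through one. *)
Definition above (e : edge m n) : bool :=
  match e with inl (j, _) => j <= j0 | inr (k, _) => k <= j0 end.

Definition cut (i : 'I_n) : edge m n := inr (lift ord0 j0, i).

Lemma joined_cut e e' : joined s e e' -> above e -> ~~ above e' ->
  exists i, e' = cut i.
Proof.
case/existsP=> j /existsP[i]; have [-> /= joins|j_neq] := eqVneq j j0.
  rewrite /cut; move: joins; rewrite /smoothing /bump.
  case: ifP => _ /orP[]; rewrite !inE => /orP[] /eqP[-> ->] /=; rewrite ?leqnn //;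
    by exists i.
have /eqP j_neq' : (j : nat) != j0 by [].
rewrite /smoothing; case: ifP => _ /orP[]; rewrite !inE => /orP[] /eqP[-> ->] /=;
  rewrite /bump; lia.
Qed.

Lemma connect_cut e e' : connect (joined s) e e' -> above e -> ~~ above e' ->
  exists i, connect (joined s) e (cut i).
Proof.
move=> /connectP[p]; elim: p e => [|e1 p IH] e /=; first by move=> _ -> ->.
move=> /andP[ee1 pth] e'E e_above e'_below.
have [e1_above|e1_below] := boolP (above e1).
  have [i conn_i] := IH e1 pth e'E e1_above e'_below.
  by exists i; apply: connect_trans conn_i; apply: connect1.
have [i e1E] := joined_cut ee1 e_above e1_below.
by exists i; rewrite -e1E; apply: connect1.
Qed.

Lemma above_boundary p :
  above (boundary_edge p) = (m - j0.+1 <= cyclic_pos p <= m + n + j0).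
Proof. by case: p => i /=; have := ltn_ord i; have := ltn_ord j0; lia. Qed.

End Crossings.

(** The window of row [t] consists of the boundary points above the horizontal
    level just below row [t].  An arc leaving the window must use one of the n
    vertical edges cut by this level, and distinct arcs use distinct edges. *)
Lemma realizable_few_unmatched m n (C : Cat m n) : realizable C ->
  forall t, t < m -> forall xs : seq nat, uniq xs ->
  (forall x, x \in xs -> (m - t.+1 <= x <= m + n + t) /\
     ~~ (m - t.+1 <= mate_pos C x <= m + n + t)) -> size xs <= n.
Proof.
case=> s real t tm xs xs_uniq xs_out; pose j0 := Ordinal tm.
have conn_sym := sym_connect_sym (joined_sym s).
have arc p : connect (joined s) (boundary_edge p) (boundary_edge (C p)).
  have /forallP/(_ p)/forallP/(_ (C p))/eqP := real.
  by rewrite eqxx => /esym/andP[].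
pose up (p : bpoint m n) := above j0 (boundary_edge p).
pose A := [set p : bpoint m n | up p && ~~ up (C p)].
pose g (p : bpoint m n) :=
  [pick i | connect (joined s) (boundary_edge p) (cut j0 i)].
have gP p : p \in A -> exists2 i, g p = Some i
    & connect (joined s) (boundary_edge p) (cut j0 i).
  rewrite inE => /andP[p1 p2]; rewrite /g; case: pickP => [i ci|none].
    by exists i.
  by have [i ci] := connect_cut (arc p) p1 p2; rewrite none in ci.
have g_inj : {in A &, injective g}.
  move=> p q pA qA; have [i -> ci] := gP p pA; have [k -> ck] := gP q qA.
  case=> ik; rewrite -{}ik conn_sym in ck.
  apply/eqP; apply: contraT => pq.
  have /forallP/(_ p)/forallP/(_ q)/eqP := real.
  rewrite /state_arc pq (connect_trans ci ck) => /eqP Cp.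
  by move: pA qA; rewrite !inE Cp => /andP[_ /negbTE ->].
have A_le : #|A| <= n.
  rewrite -(card_in_imset g_inj).
  apply: (@leq_trans #|[set Some i | i : 'I_n]|).
    apply/subset_leq_card/subsetP => _ /imsetP[p pA ->].
    by have [i -> _] := gP p pA; apply: imset_f.
  by rewrite (leq_trans (leq_imset_card _ _)) // card_ord.
apply: leq_trans A_le; rewrite cardE -(size_map (@cyclic_pos m n)).
apply: uniq_leq_size => // x /xs_out[x_in x_out].
have [p px] := @cyclic_pos_surj m n x ltac:(lia).
rewrite -px map_f // mem_enum inE /up !above_boundary /=.
by rewrite -mate_posE px x_in.
Qed.

(** * The norm as a sum over arcs *)

Lemma pending_ext m n b b' t : (forall s, s < t -> b s = b' s) ->
  pending m n b t = pending m n b' t.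
Proof.
elim: t => // t IH eq_b; rewrite !pendingS /entries IH ?eq_b // => s st.
by apply: eq_b; apply: ltnW.
Qed.

Local Open Scope ring_scope.

Lemma iota_coord_pos m n (p : bpoint m n) : ~~ is_bottom p ->
  iota_coord p = (cyclic_pos p).+1%:Z - (m + n)%N%:Z.
Proof. by case: p => i //= _; have := ltn_ord i; lia. Qed.

Definition arc_weight m n (x y : nat) : int :=
  Num.min (x.+1%:Z - (m + n)%N%:Z) (1 - (y.+1%:Z - (m + n)%N%:Z)).

Section Sum.
Variables (m n : nat) (C : Cat m n) (b : nat -> nat).
Hypothesis b_le : forall t, (b t <= n)%N.
Notation f := (mate_pos C).
Notation lo := (lo m n b).
Notation hi := (hi m n b).
Hypothesis cup : forall t, (t < m)%N -> f (lo t) = hi t.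

(** The cups of the m rows are the arcs off the bottom, each closed once: the
    points never closed are mates of bottom points. *)
Lemma sum_upper_arcs : no_bottom_returns C ->
  \sum_(pq in upper_arcs C) Num.min (iota_coord pq.1) (1 - iota_coord pq.2)
  = \sum_(j < m) arc_weight m n (lo j) (hi j).
Proof.
move=> nb.
pose pos2 (pq : bpoint m n * bpoint m n) := (cyclic_pos pq.1, cyclic_pos pq.2).
pose W (xy : nat * nat) := arc_weight m n xy.1 xy.2.
have lo_in t : (t < m)%N -> (lo t < hi t)%N /\ (hi t < m + n + m)%N.
  move=> tm; split; first exact: lo_lt_hi.
  have := hi_entries m b_le t; rewrite mem_entries //.
  by case/andP=> /andP[_ ?] _; lia.
transitivity (\sum_(xy <- [seq pos2 pq | pq <- enum (upper_arcs C)]) W xy).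
  rewrite big_map big_enum /=; apply: eq_bigr => pq.
  by rewrite inE => /and4P[_ p1 p2 _]; rewrite !iota_coord_pos.
transitivity (\sum_(xy <- [seq (lo (val j), hi (val j)) | j <- enum 'I_m]) W xy);
  last by rewrite big_map big_enum.
apply: perm_big; apply: uniq_perm.
- rewrite map_inj_uniq ?enum_uniq // => -[p q] [p' q'] [].
  by move=> /cyclic_pos_inj -> /cyclic_pos_inj ->.
- rewrite map_inj_uniq ?enum_uniq // => i j [/lo_inj e _].
  by apply: val_inj; apply: e.
have bot := pending_mates (mate_posK C) (@mate_pos_noncross _ _ C) b_le
  (fun x => mate_pos_bottom nb) cup.
move=> [x y]; apply/mapP/mapP => [[[p q]]|[j _ [-> ->]]].
  rewrite mem_enum inE => /and4P[/= /eqP Cp pu qu pq] [-> ->].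
  have fp : f (cyclic_pos p) = cyclic_pos q by rewrite mate_posE Cp.
  have {}pq : (cyclic_pos p < cyclic_pos q)%N.
    by move: pq; rewrite !iota_coord_pos //; lia.
  rewrite is_bottom_pos -ltnNge in pu; rewrite is_bottom_pos -ltnNge in qu.
  have : cyclic_pos p \notin pending m n b m.
    apply: contraL qu => /(map_f f); rewrite bot mem_rev mem_iota fp -leqNgt.
    by case/andP.
  rewrite mem_pending // subnn leq0n pu /= negbK => /mem_removedP[t tm pt].
  exists (Ordinal tm); first by rewrite mem_enum.
  case: pt => pt; first by rewrite /= -(cup tm) -pt fp.
  have := (lo_in t tm).1; rewrite -pt.
  by have := mate_posK C (lo t); rewrite (cup tm) -pt fp => <-; lia.
have [lt hiN] := lo_in j (ltn_ord j).
have [p pj] := @cyclic_pos_surj m n (lo j) ltac:(lia).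
have [q qj] := @cyclic_pos_surj m n (hi j) ltac:(lia).
exists (p, q); last by rewrite /pos2 /= pj qj.
have pu : ~~ is_bottom p by rewrite is_bottom_pos pj -ltnNge; lia.
have qu : ~~ is_bottom q by rewrite is_bottom_pos qj -ltnNge; lia.
rewrite mem_enum inE /= pu qu !iota_coord_pos // pj qj.
rewrite (_ : C p = q) ?eqxx /=; first lia.
by apply: cyclic_pos_inj; rewrite -mate_posE pj cup.
Qed.

(** Both bounds are immediate: [b t] counts entries before [lo t], and
    [hi t <= m + n + t] while [b t <= n]. *)
Lemma b_le_weight t : (t < m)%N ->
  (b t)%:Z <= (n + t)%N%:Z + arc_weight m n (lo t) (hi t).
Proof.
move=> tm; have := b_le_lo b_le tm; have := b_le t.
have := hi_entries m b_le t; rewrite mem_entries // => /andP[/andP[_ hi_le] _].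
by rewrite /arc_weight minEle; case: ifP => _; lia.
Qed.

Lemma b_eq_weight t : (t < m)%N ->
  (b t + (m - t.+1) = lo t)%N \/ (b t = n /\ hi t = (m + n + t)%N) ->
  (b t)%:Z = (n + t)%N%:Z + arc_weight m n (lo t) (hi t).
Proof.
move=> tm val_b; have := b_le_weight tm; rewrite /arc_weight minEle.
by case: ifP; lia.
Qed.

End Sum.

Lemma sum_offsets m n :
  (\sum_(j < m) (n + j) = m * n + (m * (m - 1)) %/ 2)%N.
Proof.
rewrite big_split /= sum_nat_const card_ord; congr addn.
by rewrite -(big_mkord xpredT (fun i => i)) bin2_sum bin2 subn1 divn2.
Qed.

Lemma seq_norm_ones m n (b : m.-tuple 'I_n.+1) :
  seq_norm b = (\sum_(j < m) ones b j)%N.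
Proof. by apply: eq_bigr => j _; rewrite ones_tnth. Qed.

Theorem corollary4p9 (m n : nat) (C : Cat m n)
    (hreal : realizable C) (hbot : no_bottom_returns C) :
  (beta C)%:Z =
    (m * n)%N%:Z + ((m * (m - 1)) %/ 2)%N%:Z
    + \sum_(pq in upper_arcs C)
        Num.min (iota_coord pq.1) (1 - iota_coord pq.2).
Proof.
set V := RHS.
have VE b : (forall t, (b t <= n)%N) ->
    (forall t, (t < m)%N -> mate_pos C (lo m n b t) = hi m n b t) ->
    V = \sum_(j < m) ((n + j)%N%:Z + arc_weight m n (lo m n b j) (hi m n b j)).
  move=> b_le cup; rewrite /V (sum_upper_arcs b_le cup hbot) big_split /=.
  by rewrite -PoszD -sum_offsets (big_morph Posz PoszD (erefl _)).
have norm_le b : b \in realizing_seqs C -> (seq_norm b)%:Z <= V.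
  rewrite inE => real; have b_le := @ones_le _ _ b.
  rewrite (VE _ b_le (realizes_cups real)) seq_norm_ones.
  rewrite (big_morph Posz PoszD (erefl _)).
  by apply: ler_sum => j _; apply: b_le_weight.
pose f := mate_pos C; pose g := greedy m n f.
have g_le t : (g t <= n)%N by exact: greedy_le.
pose b0 := [tuple Ordinal (g_le j : (g j < n.+1)%N) | j < m].
have onesE t : (t < m)%N -> ones b0 t = g t.
  by move=> tm; rewrite (ones_tnth b0 (Ordinal tm)) tnth_mktuple.
have pend t : (t < m)%N -> pending m n (ones b0) t = pending m n g t.
  by move=> tm; apply: pending_ext => s st; apply/onesE/(ltn_trans st).
have loE t : (t < m)%N -> lo m n (ones b0) t = lo m n g t.
  by move=> tm; rewrite /lo /entries pend // onesE.
have hiE t : (t < m)%N -> hi m n (ones b0) t = hi m n g t.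
  by move=> tm; rewrite /hi /entries pend // onesE.
have fK : involutive f := mate_posK C.
have f_nc := @mate_pos_noncross _ _ C.
have f_neq x : (x < m + n + m)%N -> f x != x.
  by move=> xN; apply: mate_pos_neq; lia.
have g_max := greedyE m n f.
have f_few := realizable_few_unmatched hreal.
have cup t : (t < m)%N -> f (lo m n g t) = hi m n g t.
  exact: (greedy_cup fK f_nc f_neq g_le g_max f_few).
have cup0 t : (t < m)%N -> f (lo m n (ones b0) t) = hi m n (ones b0) t.
  by move=> tm; rewrite loE // hiE // cup.
have b0_real : b0 \in realizing_seqs C by rewrite inE cups_realize.
have norm_b0 : (seq_norm b0)%:Z = V.
  rewrite (VE g g_le cup) seq_norm_ones (big_morph Posz PoszD (erefl _)).
  apply: eq_bigr => j _; rewrite onesE //; apply: b_eq_weight => //.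
  exact: (greedy_value fK f_nc f_neq g_le g_max f_few).
rewrite -norm_b0; congr Posz; apply/eqP; rewrite eqn_leq.
rewrite (leq_bigmax_cond _ b0_real) andbT.
apply/bigmax_leqP => b b_real.
by rewrite -lez_nat norm_b0 norm_le.
Qed.
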